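(* Let $H$ be a (not necessarily bounded) self-adjoint operator on a Hilbert space $\mathcal{B}$. If $f\in C_0(\mathbf{R})$, then $$\sigma(f(H))\subseteq\overline{f(\sigma(H))}.$$
   Context: $C_0(\mathbf{R})$ is the algebra of continuous complex-valued functions on $\mathbf{R}$ vanishing at infinity, with supremum norm $\|\cdot\|_\infty$, and $\mathcal{L}(\mathcal{B})$ is the algebra of bounded operators on $\mathcal{B}$. For $f\in C_0(\mathbf{R})$, $f(H)$ denotes the image of $f$ under the functional calculus $C_0(\mathbf{R})\to\mathcal{L}(\mathcal{B})$, $f\mapsto f(H)$, which is the unique map such that: (1) $f\mapsto f(H)$ is an algebra homomorphism; (2) $\overline{f}(H)=f(H)^*$; (3) $\|f(H)\|\le\|f\|_\infty$; (4) if $z\notin\mathbf{R}$ and $g_z(x):=(z-x)^{-1}$ for $x\in\mathbf{R}$, then $g_z(H)=(z-H)^{-1}$. Also $f(\sigma(H)):=\{f(x):x\in\sigma(H)\}$. *)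

(* Defs.v *)
From HB Require Import structures.
From mathcomp Require Import all_boot all_order all_algebra.
From mathcomp Require Import complex.
From mathcomp Require Import all_classical all_reals all_analysis.

Set Implicit Arguments.
Unset Strict Implicit.
Unset Printing Implicit Defensive.

Import Order.TTheory GRing.Theory Num.Theory.
Import numFieldNormedType.Exports.
Local Open Scope classical_set_scope.
Local Open Scope ring_scope.
Local Open Scope complex_scope.

(* Norms over R[i] take their values in R[i], although they are real. *)
Definition rnorm (R : realType) (V : normedModType R[i]) (x : V) : R :=
  complex.Re `|x|.

Section Operators.
Variables (R : realType) (B : normedModType R[i]).

(* The values of [op] outside [dom] are irrelevant. *)
Record operator := Operator {
  dom : set B;
  op :> B -> B;
  dom0 : dom 0;
  dom_linear : forall (a : R[i]) x y, dom x -> dom y -> dom (a *: x + y);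
  op_linear : forall (a : R[i]) x y,
    dom x -> dom y -> op (a *: x + y) = a *: op x + op y }.

Definition bounded_op (T : {linear B -> B}) : Prop :=
  bounded_near T (nbhs (0 : B)).

Definition opnorm (T : {linear B -> B}) : R :=
  sup [set rnorm (T x) | x in [set x | rnorm x <= 1]].

Lemma linear_domP (T : {linear B -> B}) (a : R[i]) (x y : B) :
  [set: B] x -> [set: B] y -> T (a *: x + y) = a *: T x + T y.
Proof. by move=> _ _; exact: linearP. Qed.

(* A linear map on all of B, seen as an operator with domain B. *)
Definition everywhere (T : {linear B -> B}) : operator :=
  @Operator [set: B] T I (fun _ _ _ _ _ => I) (@linear_domP T).

(* S = (z - T)^-1, as a two-sided inverse of z - T : dom T -> B. *)
Definition is_resolvent (T : operator) (z : R[i]) (S : {linear B -> B}) : Prop :=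
  [/\ forall x, dom T (S x),
      forall x, z *: S x - T (S x) = x
    & forall x, dom T x -> S (z *: x - T x) = x].

Definition spectrum (T : operator) : set R[i]^o :=
  [set z | ~ exists S : {linear B -> B}, bounded_op S /\ is_resolvent T z S].

(* Equality of graphs: S = T^*, equality of domains included. *)
Definition is_adjoint (dot : {dot B for Num.conj}) (T S : operator) : Prop :=
  forall y z, (dom S y /\ S y = z) <->
    (forall x, dom T x -> dot (T x) y = dot x z).

Definition self_adjoint (dot : {dot B for Num.conj}) (T : operator) : Prop :=
  dense (dom T) /\ is_adjoint dot T T.

End Operators.

Section FunctionalCalculus.
Variables (R : realType).

(* R[i]^o is R[i] with the topology of its norm. *)
Definition C0 (f : R -> R[i]^o) : Prop :=
  [/\ continuous f, f x @[x --> +oo] --> (0 : R[i]^o)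
    & f x @[x --> -oo] --> (0 : R[i]^o)].

Definition supnorm (f : R -> R[i]^o) : R := sup (range (fun x => rnorm (f x))).

Definition resolvent_fun (z : R[i]) (x : R) : R[i]^o := (z - x%:C)^-1.

(* [Phi f] stands for f(H): the four properties that determine f |-> f(H)
   uniquely on C0. Values of [Phi] outside C0 are unconstrained. *)
Record functional_calculus (B : normedModType R[i])
    (dot : {dot B for Num.conj}) (H : operator B)
    (Phi : (R -> R[i]^o) -> {linear B -> B}) : Prop := {
  calculus_bounded : forall f, C0 f -> bounded_op (Phi f);
  calculus_linear : forall (a : R[i]) f g, C0 f -> C0 g ->
    forall v, Phi (fun x => a * f x + g x) v = a *: Phi f v + Phi g v;
  calculus_mul : forall f g, C0 f -> C0 g ->
    forall v, Phi (fun x => f x * g x) v = Phi f (Phi g v);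
  calculus_conj : forall f, C0 f ->
    is_adjoint dot (everywhere (Phi f)) (everywhere (Phi (fun x => (f x)^*)));
  calculus_norm : forall f, C0 f -> opnorm (Phi f) <= supnorm f;
  calculus_resolvent : forall z : R[i], complex.Im z != 0 ->
    is_resolvent H z (Phi (resolvent_fun z)) }.

End FunctionalCalculus.

(* Main.v *)
Require Import Defs.
From mathcomp Require Import all_boot all_order all_algebra.
From mathcomp Require Import complex finmap.
From mathcomp Require Import all_classical all_reals all_analysis.
From mathcomp Require Import ring lra.

(** Write [f(H)] for [Phi f] and let [z] be a point outside the closure of
   [f(spectrum H)], so that [|z - f| >= e > 0] on the spectrum of [H].

   The heart of the matter is that [g(H) = 0] whenever [g] in [C0] vanishes on
   the spectrum of [H] ([calculus_eq0_on_spectrum]).  The kernel of [g |-> g(H)]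
   is a closed ideal, so this is a matter of finding enough functions in it.
   Near a real point [c] outside the spectrum there is one: if [p] is a bump
   supported close to [c] and [w = p(H) v], then [(c - H) w] is [m(H) w] for
   every [m] that agrees with [c - x] on the support of [p].  Such an [m] can be
   uniformly small, whereas the resolvent at [c] is bounded; hence [w = 0]
   ([annihilated_bump]).  For [eta > 0] the set [{|g| >= eta}] is compact and
   misses the spectrum, so finitely many bumps cover it; their sum [P] is killed
   by the calculus, and so is [g P / max(P, 1)], which is within [eta] of [g].

   To invert [z - f(H)], let [Q] be a continuous function on the complex plane
   with [(z - w) Q w = 1] for [|z - w| >= e], and set
   [S = Q 0 + (Q o f - Q 0)(H)].  The function [(z - f) (Q o f) - 1] vanishes on
   the spectrum, but it tends to [z Q 0 - 1] at infinity, which need not be [0].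
   Multiplying it by [(i - x)^-1] brings it into [C0] and yields
   [(i - H)^-1 ((z - f(H)) S - 1) = 0]; a resolvent is injective, so
   [(z - f(H)) S = 1], and [S] commutes with [f(H)].  Passing through
   the resolvent makes [z = 0] no different from the other values of [z]. *)

Set Implicit Arguments.
Unset Strict Implicit.
Unset Printing Implicit Defensive.

Import Order.TTheory GRing.Theory Num.Theory.
Import numFieldNormedType.Exports.
Local Open Scope classical_set_scope.
Local Open Scope ring_scope.
Local Open Scope complex_scope.

(** * Real-valued norms *)

Section RealNorm.
Context {R : realType} {V : normedModType R[i]}.
Implicit Types (x y : V).

Lemma normE_rnorm x : `|x| = (rnorm x)%:C.
Proof. by rewrite /rnorm RRe_real // normr_real. Qed.

Lemma rnorm_ge0 x : 0 <= rnorm x.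
Proof. by rewrite -ler0c -normE_rnorm. Qed.

Lemma rnorm0 : rnorm (0 : V) = 0.
Proof. by rewrite /rnorm normr0. Qed.

Lemma rnorm_le0 x : rnorm x <= 0 -> x = 0.
Proof.
move=> x0; apply/eqP; rewrite -normr_eq0 normE_rnorm.
by rewrite (@le_anti _ _ (rnorm x) 0) ?x0 ?rnorm_ge0.
Qed.

Lemma rnormN x : rnorm (- x) = rnorm x.
Proof. by rewrite /rnorm normrN. Qed.

Lemma rnormB x y : rnorm (x - y) = rnorm (y - x).
Proof. by rewrite -rnormN opprB. Qed.

Lemma rnormD x y : rnorm (x + y) <= rnorm x + rnorm y.
Proof. by rewrite -lecR rmorphD /= -!normE_rnorm ler_normD. Qed.

Lemma rnormZ (a : R[i]) x : rnorm (a *: x) = rnorm (a : R[i]^o) * rnorm x.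
Proof.
by apply: complexI; rewrite rmorphM /= -!normE_rnorm normrZ.
Qed.

(** Balls in a normed module over [R[i]] have radii in [R[i]]; this trades them
    for real radii, so that all later estimates take place in [R]. *)
Lemma cvg_rnormP {T : Type} {F : set_system T} {FF : Filter F} (f : T -> V) y :
  f @ F --> y <-> forall e : R, 0 < e -> \forall t \near F, rnorm (y - f t) < e.
Proof.
split=> [/cvgrPdist_lt fy e e0|fy].
  have /fy : 0 < e%:C :> R[i] by rewrite ltcR.
  by apply: filterS => t; rewrite normE_rnorm ltcR.
apply/cvgrPdist_lt => e e0.
have ee : e = (complex.Re e)%:C by rewrite RRe_real // gtr0_real.
have /fy : 0 < complex.Re e by rewrite -ltcR -ee.
by apply: filterS => t; rewrite normE_rnorm ee ltcR.
Qed.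

Lemma near_rnorm x (e : R) : 0 < e -> \forall y \near x, rnorm (x - y) < e.
Proof. by move=> e0; have /cvg_rnormP/(_ e e0) := @cvg_id _ (nbhs x). Qed.

Lemma continuous_rnorm : continuous (@rnorm R V).
Proof.
move=> x; apply/cvgrPdist_lt => e e0.
have := near_rnorm x e0; apply: filterS => y; apply: le_lt_trans.
rewrite ler_norml; apply/andP; split.
  have := rnormD x (y - x); rewrite addrC subrK (rnormB y); lra.
have := rnormD y (x - y); rewrite addrC subrK; lra.
Qed.

End RealNorm.

Section ComplexNorm.
Context {R : realType}.
Implicit Types (z w : R[i]^o) (r : R).

Lemma rnormM z w : rnorm (z * w : R[i]^o) = rnorm z * rnorm w.
Proof. exact: rnormZ. Qed.

Lemma rnorm_real r : rnorm (r%:C : R[i]^o) = `|r|.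
Proof.
by apply: complexI; rewrite -normE_rnorm normc_def /= expr0n addr0 sqrtr_sqr.
Qed.

Lemma rnorm1 : rnorm (1 : R[i]^o) = 1.
Proof. by rewrite (rnorm_real 1) normr1. Qed.

Lemma continuous_real_complex : continuous (fun r => r%:C : R[i]^o).
Proof.
move=> r; apply/cvg_rnormP => e e0.
have /cvgrPdist_lt/(_ e e0) : id @ r --> r by exact: cvg_id.
by apply: filterS => y; rewrite -rmorphB rnorm_real.
Qed.

Lemma continuous_conjc : continuous (fun z => z^* : R[i]^o).
Proof.
move=> z; apply/(@cvg_rnormP _ R[i]^o _ (nbhs (z : R[i]^o))) => e e0.
have := @near_rnorm _ R[i]^o z _ e0.
by apply: filterS => y; rewrite -rmorphB /rnorm normcJ.
Qed.

Lemma mulrJ_rnorm z : z * z^* = (rnorm z ^+ 2)%:C.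
Proof. by rewrite rmorphXn /= -normE_rnorm; exact/esym/sqr_normc. Qed.

End ComplexNorm.

(** * Bounded operators *)

Section BoundedOperators.
Context {R : realType} {B : normedModType R[i]}.
Implicit Types (T : {linear B -> B}).

Lemma bounded_opP T :
  bounded_op T <-> exists C : R, forall x, rnorm (T x) <= C * rnorm x.
Proof.
split=> [/linear_boundedP/pinfty_ex_gt0[M M0 TM]|[C TC]].
  have MM : M = (complex.Re M)%:C by rewrite RRe_real // gtr0_real.
  exists (complex.Re M) => x.
  by rewrite -lecR rmorphM /= -!normE_rnorm -MM.
apply/linear_boundedP; near=> M => x.
apply: (@le_trans _ _ (C%:C * `|x|)).
  by rewrite !normE_rnorm -rmorphM lecR.
apply: ler_wpM2r => //.
near: M; apply: nbhs_pinfty_ge; apply/complex_realP; by exists C.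
Unshelve. all: by end_near. Qed.

Lemma rnorm_opnorm T x : bounded_op T -> rnorm (T x) <= opnorm T * rnorm x.
Proof.
move=> /bounded_opP[C TC].
have [x0|x0] := leP (rnorm x) 0.
  by rewrite (rnorm_le0 x0) linear0 rnorm0 mulr0.
pose u := (rnorm x)^-1%:C *: x.
have u1 : rnorm u = 1.
  by rewrite rnormZ rnorm_real gtr0_norm ?invr_gt0// mulVf ?gt_eqF.
have -> : x = (rnorm x)%:C *: u.
  by rewrite scalerA -rmorphM /= divff ?scale1r// gt_eqF.
rewrite linearZ /= rnormZ [rnorm (_ *: u)]rnormZ u1 mulr1 mulrC rnorm_real.
rewrite (gtr0_norm x0) ler_pM2r//.
apply: ub_le_sup; last by exists u => //=; rewrite u1.
exists `|C| => _ [v /= v1 <-]; apply: (le_trans (TC v)).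
apply: (@le_trans _ _ (`|C| * rnorm v)).
  by rewrite ler_wpM2r ?rnorm_ge0 ?ler_norm.
by rewrite -[leRHS]mulr1 ler_wpM2l.
Qed.

End BoundedOperators.

(** * Functions vanishing at infinity *)

Lemma continuous_maxr {R : realType} {T : topologicalType} (f g : T -> R) :
  continuous f -> continuous g -> continuous (fun x => Num.max (f x) (g x)).
Proof. by move=> cf cg x; exact: (@continuous_max R T f g x (cf x) (cg x)). Qed.

Lemma continuous_minr {R : realType} {T : topologicalType} (f g : T -> R) :
  continuous f -> continuous g -> continuous (fun x => Num.min (f x) (g x)).
Proof. by move=> cf cg x; exact: (@continuous_min R T f g x (cf x) (cg x)). Qed.

Section VanishingFunctions.
Context {R : realType}.
Implicit Types (f g : R -> R[i]^o).

(** The two limits at infinity merge into one estimate in [|x|]. *)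
Lemma C0P f : C0 f <-> continuous f /\
  forall e : R, 0 < e -> exists M : R, forall x, M < `|x| -> rnorm (f x) < e.
Proof.
split=> [[cf /cvg_rnormP fy /cvg_rnormP fNy]|[cf f0]].
  split=> // e e0.
  have [M [_ yM]] := fy e e0; have [N [_ yN]] := fNy e e0.
  exists (Num.max M (- N)) => x; rewrite gt_max => /andP[].
  have [x0|x0] := ltP 0 x.
    by rewrite gtr0_norm// => /yM + _; rewrite sub0r rnormN.
  by rewrite ler0_norm// ltrN2 => _ /yN; rewrite sub0r rnormN.
split=> //; apply/cvg_rnormP => e /f0[M Mf].
  near=> x; rewrite sub0r rnormN; apply: Mf.
  apply: lt_le_trans (ler_norm _).
  by near: x; exact: nbhs_pinfty_gt (num_real _).
near=> x; rewrite sub0r rnormN; apply: Mf.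
rewrite -normrN; apply: lt_le_trans (ler_norm _); rewrite ltrNr.
by near: x; exact: nbhs_ninfty_lt (num_real _).
Unshelve. all: by end_near. Qed.

Lemma C0_dominated (C : R) f g : continuous g -> C0 f ->
  (forall x, rnorm (g x) <= C * rnorm (f x)) -> C0 g.
Proof.
move=> cg /C0P[_ f0] gf; apply/C0P; split=> // e e0.
pose D := `|C| + 1.
have D0 : 0 < D by rewrite ltr_pwDr.
have /f0[M Mf] : 0 < e / D by rewrite divr_gt0.
exists M => x /Mf; rewrite ltr_pdivlMr// => fe.
apply: le_lt_trans fe; apply: (le_trans (gf x)).
rewrite mulrC; apply: ler_wpM2l; first exact: rnorm_ge0.
by rewrite (le_trans (ler_norm _))// lerDl.
Qed.

Lemma C0_compact_support (M : R) f : continuous f ->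
  (forall x, M < `|x| -> f x = 0) -> C0 f.
Proof.
move=> cf f0; apply/C0P; split=> // e e0.
by exists M => x /f0 ->; rewrite rnorm0.
Qed.

Lemma cvg_linear0 {T : Type} {F : set_system T} {FF : Filter F} (a : R[i])
    (f g : T -> R[i]^o) :
  f @ F --> (0 : R[i]^o) -> g @ F --> (0 : R[i]^o) ->
  a * f x + g x @[x --> F] --> (0 : R[i]^o).
Proof.
move=> f0 g0; have := cvgD (cvgM (cvg_cst (a : R[i]^o)) f0) g0.
by rewrite mulr0 addr0; apply.
Qed.

Lemma C0_linear (a : R[i]) f g : C0 f -> C0 g -> C0 (fun x => a * f x + g x).
Proof.
move=> [cf fy fNy] [cg gy gNy]; split=> [x||]; last 2 first.
- exact: (cvg_linear0 a fy gy).
- exact: (cvg_linear0 a fNy gNy).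
by apply: cvgD; [apply: cvgM; [exact: cvg_cst|exact: cf]|exact: cg].
Qed.

Lemma C0_cst0 : C0 (fun=> 0 : R[i]^o).
Proof. by split=> [x||]; exact: cvg_cst. Qed.

Lemma C0_mul f g : C0 f -> C0 g -> C0 (fun x => f x * g x).
Proof.
move=> [cf fy fNy] [cg gy gNy]; split=> [x||].
- by apply: cvgM; [exact: cf|exact: cg].
- by have := cvgM fy gy; rewrite mulr0; apply.
- by have := cvgM fNy gNy; rewrite mulr0; apply.
Qed.

Lemma C0_comp f (Q : R[i]^o -> R[i]^o) : C0 f -> continuous Q -> Q 0 = 0 ->
  C0 (fun x => Q (f x)).
Proof.
move=> [cf fy fNy] cQ Q0; split=> [x||].
- by apply: continuous_comp; [exact: cf|exact: cQ].
- by have := continuous_cvg _ (cQ 0) fy; rewrite Q0; apply.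
- by have := continuous_cvg _ (cQ 0) fNy; rewrite Q0; apply.
Qed.

(** [|i - x| >= |x|], since the real part of [i - x] is [- x]. *)
Lemma C0_resolvent_fun_i : C0 (resolvent_fun ('i : R[i])).
Proof.
have ix (x : R) : 'i - x%:C != 0 :> R[i].
  by rewrite eq_complex /= oppr0 addr0 oner_eq0 andbF.
apply/C0P; split=> [x|e e0].
  apply: cvgV; first exact: ix.
  exact: (cvgB (cvg_cst ('i : R[i]^o)) (@continuous_real_complex R x)).
exists e^-1 => x ex.
have x0 : 0 < `|x| by rewrite (lt_trans _ ex)// invr_gt0.
have xi : `|x| <= rnorm ('i - x%:C : R[i]^o).
  rewrite -lecR -normE_rnorm; apply: le_trans (normc_ge_Re _).
  by rewrite lecR /= sub0r normrN.
have i0 := lt_le_trans x0 xi.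
have -> : rnorm (resolvent_fun 'i x) = (rnorm ('i - x%:C : R[i]^o))^-1.
  apply: (mulfI (lt0r_neq0 i0)); rewrite -rnormM (divff (lt0r_neq0 i0)).
  by rewrite /resolvent_fun (mulfV (ix x)) rnorm1.
by rewrite invf_plt ?posrE//; exact: lt_le_trans xi.
Qed.

(** The tent centred at [c], of height [h] and slope [1 / d]: it is supported on
    [|x - c| <= h d] and is at least [1] on [|x - c| <= (h - 1) d], so that
    tents of heights [2] and [3] provide a bump and a cutoff equal to [1] on the
    support of that bump. *)
Definition tent (h d c x : R) : R := Num.max 0 (h - `|x - c| / d).

Lemma continuous_tent h d c : continuous (tent h d c).
Proof.
apply: continuous_maxr => x; first exact: cvg_cst.
apply: cvgB; first exact: cvg_cst.
apply: cvgM; last exact: cvg_cst.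
by apply: cvg_norm; apply: cvgB; [exact: cvg_id|exact: cvg_cst].
Qed.

Lemma tent_eq0 h d c x : 0 < d -> h * d <= `|x - c| -> tent h d c x = 0.
Proof. by move=> d0 hx; apply/max_l; rewrite subr_le0 ler_pdivlMr. Qed.

Lemma C0_tentM h d c (u : R -> R[i]^o) : 0 < d -> continuous u ->
  C0 (fun x => u x * (tent h d c x)%:C).
Proof.
move=> d0 cu; apply: (@C0_compact_support (h * d + `|c|)).
  move=> x; apply: cvgM; first exact: cu.
  apply: continuous_comp; first exact: continuous_tent.
  exact: continuous_real_complex.
move=> x hx; rewrite tent_eq0 ?mulr0//.
by have := lerB_dist x c; lra.
Qed.

End VanishingFunctions.

(** * The functional calculus *)

Section Calculus.
Context {R : realType} {B : normedModType R[i]} {dot : {dot B for Num.conj}}.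
Context {H : operator B} {Phi : (R -> R[i]^o) -> {linear B -> B}}.
Hypothesis calcPhi : functional_calculus dot H Phi.
Implicit Types (f g : R -> R[i]^o) (v : B).

Lemma calculus_le (C : R) f v : C0 f -> (forall x, rnorm (f x) <= C) ->
  rnorm (Phi f v) <= C * rnorm v.
Proof.
move=> f0 fC; apply: (le_trans (rnorm_opnorm _ (calculus_bounded calcPhi f0))).
apply: ler_wpM2r; first exact: rnorm_ge0.
apply: (le_trans (calculus_norm calcPhi f0)); apply: ge_sup.
  by exists (rnorm (f 0)); exists 0.
by move=> _ [x _ <-].
Qed.

Lemma calculus_zero v : Phi (fun=> 0) v = 0.
Proof.
apply: rnorm_le0; rewrite -(mul0r (rnorm v)); apply: calculus_le.
  exact: C0_cst0.
by move=> x; rewrite rnorm0.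
Qed.

(** How the calculus sees the unbounded operator [H], about which only the
    resolvents speak: [f] is the product of [(i - x)^-1] and [(i - x) f], so
    [f(H) v] is the resolvent at [i] applied to something. *)
Lemma calculus_shift (c : R) f v :
  C0 f -> C0 (fun x => ('i - x%:C) * f x : R[i]^o) ->
  dom H (Phi f v) /\
  c%:C *: Phi f v - H (Phi f v) = Phi (fun x => (c - x)%:C * f x) v.
Proof.
move=> f0 if0.
have [domR RK _] : is_resolvent H 'i (Phi (resolvent_fun 'i)).
  by apply: (calculus_resolvent calcPhi); rewrite /= oner_neq0.
have fE : f = fun x => resolvent_fun 'i x * (('i - x%:C) * f x).
  apply/funext => x; rewrite mulrA mulVf ?mul1r//.
  by rewrite eq_complex /= oppr0 addr0 oner_eq0 andbF.
have PfE : Phi f v =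
    Phi (resolvent_fun 'i) (Phi (fun x => ('i - x%:C) * f x) v).
  by rewrite -(calculus_mul calcPhi) -?fE//; exact: C0_resolvent_fun_i.
split; first by rewrite PfE.
have -> : (fun x => (c - x)%:C * f x : R[i]^o) =
    fun x => (c%:C - 'i) * f x + ('i - x%:C) * f x.
  by apply/funext => x; rewrite -mulrDl addrA subrK rmorphB.
rewrite (calculus_linear calcPhi)// scalerBl -addrA; congr (_ + _).
rewrite -[Phi (fun x => ('i - x%:C) * f x) v]RK -PfE.
by rewrite addrA addNr add0r.
Qed.

(** Real and nonnegative, so that a sum of such functions is positive wherever
    one of them is. *)
Definition annihilated (p : R -> R) : Prop :=
  [/\ continuous p, forall x, 0 <= p x, C0 (fun x => (p x)%:C : R[i]^o)
    & forall v, Phi (fun x => (p x)%:C) v = 0].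

(** If [p] is supported in [|x - c| <= 2 d] and [w = p(H) v], then
    [w = S (c - H) w = S m(H) w] with [|m| <= 3 d]; when [3 d] times the norm of
    the resolvent [S] is below [1], this forces [w = 0]. *)
Lemma annihilated_bump (c : R) : ~ spectrum H c%:C ->
  exists2 p, annihilated p & 1 < p c.
Proof.
move=> /contrapT[S [/bounded_opP[C SC] [_ _ SK]]].
pose d := (6 * (`|C| + 1))^-1.
have d0 : 0 < d by rewrite invr_gt0 mulr_gt0// ltr_wpDl.
have Cd : `|C| * (3 * d) <= 1 / 2.
  have : d * (6 * (`|C| + 1)) = 1 by rewrite mulVf// gt_eqF// -invr_gt0.
  by lra.
have ctC h : continuous (fun x => (tent h d c x)%:C : R[i]^o).
  move=> x; apply: continuous_comp; first exact: continuous_tent.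
  exact: continuous_real_complex.
have p0 : C0 (fun x => (tent 2 d c x)%:C : R[i]^o).
  have -> : (fun x => (tent 2 d c x)%:C : R[i]^o) =
      fun x => 1 * (tent 2 d c x)%:C by apply/funext => x; rewrite mul1r.
  exact: (@C0_tentM R 2 d c (fun=> 1 : R[i]^o) d0 (fun x => cvg_cst _)).
exists (tent 2 d c); last first.
  by rewrite /tent subrr normr0 mul0r subr0 lt_max ltr1n orbT.
split=> // [|x|v]; [exact: continuous_tent|by rewrite le_max lexx|].
pose w := Phi (fun x => (tent 2 d c x)%:C) v; rewrite -/w.
have [domw wE] : dom H w /\
    c%:C *: w - H w = Phi (fun x => (c - x)%:C * (tent 2 d c x)%:C) v.
  apply: calculus_shift => //.
  apply: C0_tentM => // x.
  exact: (cvgB (cvg_cst ('i : R[i]^o)) (@continuous_real_complex R x)).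
(* [c - x] on [|x - c| <= 2 d], cut off outside [|x - c| <= 3 d]. *)
pose m x : R[i]^o := ((c - x) * Num.min 1 (tent 3 d c x))%:C.
have m3 x : rnorm (m x) <= 3 * d.
  rewrite rnorm_real normrM [X in _ * X]ger0_norm; last first.
    by rewrite le_min ler01 le_max lexx.
  have [x3|x3] := leP (3 * d) `|x - c|.
    by rewrite tent_eq0// min_r// mulr0 mulr_ge0 ?ltW.
  apply: le_trans (ltW x3); rewrite distrC -[leRHS]mulr1.
  by apply: ler_wpM2l => //; rewrite ge_min lexx.
have m0 : C0 m.
  apply: (@C0_compact_support _ (3 * d + `|c|)).
    move=> x; apply: (@continuous_comp _ _ _
      (fun x => (c - x) * Num.min 1 (tent 3 d c x)));
      last exact: continuous_real_complex.
    apply: cvgM; first by apply: cvgB; [exact: cvg_cst|exact: cvg_id].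
    exact: (continuous_minr (fun=> cvg_cst _) (@continuous_tent R 3 d c)).
  move=> x hx; rewrite /m tent_eq0 ?min_r ?mulr0//.
  by have := lerB_dist x c; lra.
have mw : c%:C *: w - H w = Phi m w.
  rewrite wE /w -(calculus_mul calcPhi)//; congr (Phi _ v).
  apply/funext => x; rewrite /m -!rmorphM /=; congr (_%:C).
  have [x2|x2] := leP (2 * d) `|x - c|.
    by rewrite (@tent_eq0 R 2)// !mulr0.
  rewrite min_l ?mulr1// le_max; apply/orP; right.
  by rewrite lerBrDl -lerBrDr ler_pdivrMr//; lra.
apply: rnorm_le0; suff : rnorm w <= 1 / 2 * rnorm w by lra.
rewrite -{1}(SK _ domw) mw; apply: (le_trans (SC _)).
apply: (@le_trans _ _ (`|C| * rnorm (Phi m w))).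
  by rewrite ler_wpM2r ?rnorm_ge0 ?ler_norm.
apply: (@le_trans _ _ (`|C| * (3 * d * rnorm w))).
  by rewrite ler_wpM2l//; exact: calculus_le.
by rewrite mulrA ler_wpM2r ?rnorm_ge0.
Qed.

Lemma annihilated_sum (s : seq (R -> R)) :
  (forall p, p \in s -> annihilated p) ->
  annihilated (fun x => \sum_(p <- s) p x).
Proof.
elim: s => [_|p s IH ps].
  have -> : (fun x => \sum_(p <- [::]) p x) = (fun=> 0) :> (R -> R).
    by apply/funext => x; rewrite big_nil.
  split=> [x|x||v].
  - exact: cvg_cst.
  - exact: lexx.
  - exact: C0_cst0.
  - exact: calculus_zero.
have [cp p0 Cp Pp] := ps p (mem_head _ _).
have [q qs|cs s0 Cs Ps] := IH; first by apply: ps; rewrite in_cons qs orbT.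
have -> : (fun x => \sum_(q <- p :: s) q x) =
    fun x => p x + \sum_(q <- s) q x.
  by apply/funext => x; rewrite big_cons.
have E : (fun x => (p x + \sum_(q <- s) q x)%:C : R[i]^o) =
    fun x => 1 * (p x)%:C + (\sum_(q <- s) q x)%:C.
  by apply/funext => x; rewrite mul1r rmorphD.
split=> [x|x||v].
- by apply: cvgD; [exact: cp|exact: cs].
- by rewrite addr_ge0.
- by rewrite E; exact: C0_linear.
- by rewrite E (calculus_linear calcPhi)// Pp Ps scaler0 addr0.
Qed.

(** It suffices to approximate [g] uniformly within [eta] by functions killed by
    the calculus.  On the compact set [K] where [|g| >= eta], a finite sum [P]
    of bumps is at least [1]; then [h = g P / max(P, 1)] equals [g] on [K] and is
    [g] times a number in [[0, 1]] elsewhere, where [|g| < eta]. *)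
Lemma calculus_eq0_on_spectrum g v :
  C0 g -> (forall x, spectrum H x%:C -> g x = 0) -> Phi g v = 0.
Proof.
move=> g0 gH; have [cg gM] := (C0P g).1 g0.
suff small (eta : R) : 0 < eta -> rnorm (Phi g v) <= eta * rnorm v.
  apply: rnorm_le0; apply/ler_addgt0Pr => e e0; rewrite add0r.
  have v1 : 0 < rnorm v + 1 by rewrite ltr_wpDl ?rnorm_ge0.
  apply: le_trans (small _ (divr_gt0 e0 v1)) _.
  by rewrite mulrAC ler_pdivrMr// ler_wpM2l ?(ltW e0)// lerDl.
move=> eta0.
have cng : continuous (fun x => rnorm (g x)).
  by move=> x; apply: continuous_comp; [exact: cg|exact: continuous_rnorm].
pose K := [set x | eta <= rnorm (g x)].
have Kcpt : compact K.
  have [M Mg] := gM _ eta0.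
  apply: (@subclosed_compact _ _ `[- M, M]%classic).
  - exact: (@closed_comp _ _ _ _ (fun x _ => cng x) (@closed_ge _ eta)).
  - exact: segment_compact.
  - move=> x /= Kx; rewrite in_itv /= -ler_norml leNgt.
    by apply/negP => /Mg; rewrite ltNge => /negP; exact.
have [s sA Ks] : finite_subset_cover annihilated (fun p => [set x | 1 < p x]) K.
  move: Kcpt; rewrite compact_cover; apply.
    move=> p [cp _ _ _].
    exact: (@open_comp _ _ _ _ (fun x _ => cp x) (@open_gt _ 1)).
  move=> x Kx; have [p pA px] : exists2 p, annihilated p & 1 < p x.
    apply: annihilated_bump => /gH gx.
    by move: Kx; rewrite /K /= gx rnorm0 leNgt eta0.
  by exists p.
pose P x := \sum_(p <- s) p x.
have [cP P0 CP PP] : annihilated P.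
  by apply: annihilated_sum => p ps; have := sA p ps; rewrite inE.
have P1 x : K x -> 1 <= P x.
  move=> /Ks[p /= ps px]; apply: (le_trans (ltW px)).
  rewrite /P (big_rem p)//= lerDl big_seq; apply: sumr_ge0 => q /mem_rem qs.
  by have := sA q qs; rewrite inE => -[].
pose n x := Num.max (P x) 1.
have n0 x : 0 < n x by rewrite lt_max ltr01 orbT.
have cn : continuous (fun x => (n x)^-1).
  move=> x; apply: cvgV; first by rewrite gt_eqF.
  exact: (continuous_maxr cP (fun=> cvg_cst _)).
pose k x : R[i]^o := g x * (n x)^-1%:C.
have Ck : C0 k.
  apply: (@C0_dominated _ 1 g k _ g0) => x.
    apply: cvgM; first exact: cg.
    by apply: continuous_comp; [exact: cn|exact: continuous_real_complex].
  rewrite rnormM rnorm_real mulrC ler_wpM2r ?rnorm_ge0//.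
  rewrite ger0_norm; last by rewrite invr_ge0 (ltW (n0 x)).
  by rewrite invf_le1// le_max lexx orbT.
pose h x : R[i]^o := (P x)%:C * k x.
have Ch : C0 h by exact: C0_mul.
have -> : Phi g v = Phi (fun x => -1 * h x + g x) v.
  rewrite (calculus_linear calcPhi)// (calculus_mul calcPhi)// PP.
  by rewrite scaler0 add0r.
apply: calculus_le; first exact: C0_linear.
move=> x; have -> : -1 * h x + g x = g x * (1 - P x / n x)%:C.
  rewrite /h /k rmorphB rmorphM; ring.
have Pn : 0 <= P x / n x <= 1.
  by rewrite divr_ge0 ?(ltW (n0 x))//= ler_pdivrMr// mul1r le_max lexx.
rewrite rnormM rnorm_real.
have [Kx|Kx] := pselect (K x).
  rewrite /n max_l ?P1// divff ?subrr ?normr0 ?mulr0 ?ltW// gt_eqF//.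
  by rewrite (lt_le_trans ltr01) ?P1.
move/negP: Kx; rewrite -ltNge => /ltW Kx.
rewrite -[leRHS]mulr1 ler_pM ?rnorm_ge0// ger0_norm; lra.
Qed.

End Calculus.

(** * Inverting z - f(H) *)

Section Resolvent.
Context {R : realType}.

(** [(z - w)^-1] is [conj (z - w) / |z - w|^2]; bounding the denominator
    from below by [e^2] makes it continuous on the whole plane. *)
Definition cutoff_inverse (z : R[i]) (e : R) (w : R[i]^o) : R[i]^o :=
  (z - w)^* * ((Num.max (rnorm (z - w : R[i]^o) ^+ 2) (e ^+ 2))^-1)%:C.

Lemma continuous_cutoff_inverse (z : R[i]) (e : R) : 0 < e ->
  continuous (cutoff_inverse z e).
Proof.
move=> e0.
have czw : continuous (fun w : R[i]^o => z - w : R[i]^o).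
  by move=> w; exact: (cvgB (cvg_cst (z : R[i]^o)) (@cvg_id _ (nbhs w))).
have cd : continuous (fun w : R[i]^o => rnorm (z - w : R[i]^o)).
  move=> w; exact: (@continuous_comp R[i]^o R[i]^o R (fun w => z - w)
    (@rnorm R R[i]^o) w (czw w) (@continuous_rnorm R R[i]^o (z - w))).
have cj : continuous (fun w : R[i]^o => (z - w)^* : R[i]^o).
  move=> w; exact: (@continuous_comp R[i]^o R[i]^o R[i]^o (fun w => z - w)
    (fun u => u^*) w (czw w) (@continuous_conjc R (z - w))).
pose n (w : R[i]^o) : R := Num.max (rnorm (z - w : R[i]^o) ^+ 2) (e ^+ 2).
have n0 w : n w != 0 by apply: lt0r_neq0; rewrite lt_max (exprn_gt0 2 e0) orbT.
have cn : continuous n.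
  apply: continuous_maxr; last exact: (@cst_continuous R[i]^o R (e ^+ 2)).
  by move=> u; exact: (cvgM (cd u) (cd u)).
have cm : continuous (fun w => (n w)^-1).
  by move=> w; exact: (cvgV (n0 w) (cn w)).
move=> w; apply: (cvgM (cj w)).
exact: (continuous_comp (cm w) (@continuous_real_complex R _)).
Qed.

Lemma cutoff_inverseK (z : R[i]) (e : R) (w : R[i]^o) : 0 < e ->
  e <= rnorm (z - w : R[i]^o) -> (z - w) * cutoff_inverse z e w = 1.
Proof.
move=> e0 ew; rewrite /cutoff_inverse mulrA (mulrJ_rnorm (z - w)).
rewrite -rmorphM /= max_l ?divff//.
  by rewrite expf_neq0// gt_eqF// (lt_le_trans e0).
by rewrite lerXn2r// nnegrE ?rnorm_ge0// ltW.
Qed.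

End Resolvent.

Theorem lemma5p3 (R : realType) (B : completeNormedModType R[i])
    (dot : {dot B for Num.conj})
    (dot_norm : forall x : B, `|x| ^+ 2 = dot x x)
    (H : operator B) (H_sa : self_adjoint dot H)
    (Phi : (R -> R[i]^o) -> {linear B -> B})
    (Phi_calculus : functional_calculus dot H Phi)
    (f : R -> R[i]^o) (f_C0 : C0 f) :
  spectrum (everywhere (Phi f)) `<=`
    closure [set f x | x in [set x : R | spectrum H x%:C]].
Proof.
move=> z specz; apply: contrapT => nclz; apply: specz.
have [e e0 ez] : exists2 e : R, 0 < e &
    forall x : R, spectrum H x%:C -> e <= rnorm (z - f x : R[i]^o).
  apply: contrapT => noe; apply: nclz => U /nbhs_ballP[d /= d0 dU].
  have dd : d = (complex.Re d)%:C by rewrite RRe_real // gtr0_real.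
  apply: contrapT => nU; apply: noe; exists (complex.Re d).
    by rewrite -ltcR -dd.
  move=> x Hx; rewrite leNgt; apply/negP => xd; apply: nU.
  exists (f x); split; first by exists x.
  apply: dU; rewrite /ball /= dd.
  by rewrite (normE_rnorm (z - f x : R[i]^o)) ltcR.
pose Q := cutoff_inverse z e; pose q0 : R[i] := Q 0.
have cQ : continuous Q := continuous_cutoff_inverse e0.
pose g x : R[i]^o := Q (f x) - q0.
have g_C0 : C0 g.
  apply: (@C0_comp _ f (fun w => Q w - q0) f_C0); last by rewrite subrr.
  by move=> w; exact: (cvgB (cQ w) (cvg_cst (q0 : R[i]^o))).
pose r := resolvent_fun ('i : R[i]) : R -> R[i]^o.
have r_C0 : C0 r := C0_resolvent_fun_i.
have [domr rK _] : is_resolvent H 'i (Phi r).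
  by apply: (calculus_resolvent Phi_calculus); rewrite /= oner_neq0.
(* [H 0 = 0], so a vector killed by the resolvent is [i 0 - H 0]. *)
have r_inj u : Phi r u = 0 -> u = 0.
  move=> ru; rewrite -(rK u) ru scaler0 sub0r.
  have := @op_linear _ _ H (-1) 0 0 (dom0 H) (dom0 H).
  by rewrite scaler0 add0r scaleN1r addNr => ->; rewrite oppr0.
(* [(z - f) (q0 + g) - 1] is [k] plus its limit [z q0 - 1] at infinity. *)
pose k x : R[i]^o := z * g x + ((- q0) * f x + (-1 * (f x * g x) + 0)).
have fg_C0 := C0_mul f_C0 g_C0.
have k1_C0 : C0 (fun x => -1 * (f x * g x) + 0).
  by apply: C0_linear => //; exact: C0_cst0.
have k2_C0 : C0 (fun x => (- q0) * f x + (-1 * (f x * g x) + 0)).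
  exact: C0_linear.
have k_C0 : C0 k by exact: C0_linear.
have kE v : Phi k v = z *: Phi g v - q0 *: Phi f v - Phi f (Phi g v).
  rewrite !(calculus_linear Phi_calculus)//; last exact: C0_cst0.
  rewrite (calculus_mul Phi_calculus)// (calculus_zero Phi_calculus).
  by rewrite addr0 scaleN1r scaleNr addrA.
have key v : (z * q0 - 1) *: v + Phi k v = 0.
  apply: r_inj; rewrite linearD linearZ /=.
  rewrite -(calculus_mul Phi_calculus)//.
  rewrite -(calculus_linear Phi_calculus)//; last exact: C0_mul.
  apply: (calculus_eq0_on_spectrum Phi_calculus).
    by apply: C0_linear => //; exact: C0_mul.
  move=> x /ez ex.
  have : (z - f x) * Q (f x) = 1 by exact: cutoff_inverseK.
  have -> : Q (f x) = g x + q0 by rewrite subrK.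
  move=> fQ; transitivity (r x * ((z - f x) * (g x + q0) - 1)).
    by rewrite /k; ring.
  by rewrite fQ subrr mulr0.
have [S SE] : exists S : {linear B -> B}, forall v, S v = q0 *: v + Phi g v.
  by exists ((q0 \*: idfun) \+ Phi g).
exists S; split.
  have /bounded_opP[C PC] := calculus_bounded Phi_calculus g_C0.
  apply/bounded_opP; exists (rnorm (q0 : R[i]^o) + C) => v.
  rewrite SE; apply: (le_trans (rnormD _ _)).
  by rewrite rnormZ mulrDl lerD2l.
have fgC v : Phi g (Phi f v) = Phi f (Phi g v).
  rewrite -!(calculus_mul Phi_calculus)//; congr (Phi _ v).
  by apply/funext => x; rewrite mulrC.
have kK v : (z * q0) *: v + Phi k v = v.
  by apply/eqP; rewrite -subr_eq0 addrAC -[X in _ - X]scale1r -scalerBl key.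
split=> [//|v|v _] /=.
  rewrite -[RHS]kK kE SE scalerDr scalerA.
  rewrite [Phi f (_ + _)]linearD [Phi f (_ *: _)]linearZ /=.
  by rewrite opprD -!addrA.
rewrite -[RHS]kK kE SE [Phi g (_ - _)]linearB [Phi g (_ *: _)]linearZ /=.
rewrite scalerBr scalerA mulrC fgC.
by rewrite addrACA addrA -!addrA; congr (_ + _); rewrite addrCA addrA.
Qed.
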